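(* Let $D\ge 1$, let $f:\mathbb{R}^D\to\mathbb{R}$ be continuously differentiable, and let $\rho$ be a probability density on $\mathbb{R}^D$ with support the whole of $\mathbb{R}^D$. Let $$\boldsymbol{C}=\int_{\mathbb{R}^D}\nabla f(\boldsymbol{x})\nabla f(\boldsymbol{x})^T\rho(\boldsymbol{x})\,d\boldsymbol{x}\in\mathbb{R}^{D\times D},$$ where the integral is assumed to be well defined (i.e. $\int\|\nabla f(\boldsymbol{x})\|^2\rho(\boldsymbol{x})\,d\boldsymbol{x}<\infty$). Then, for an integer $0\le d_e\le D$, $\operatorname{rank}(\boldsymbol{C})=d_e$ if and only if $f$ has effective dimensionality $d_e$. In this case, the effective subspace of $f$ is $\mathcal{T}=\operatorname{range}(\boldsymbol{C})$.
   Context: A function $f:\mathbb{R}^D\to\mathbb{R}$ has effective dimensionality $d_e\le D$ if (i) there exists a linear subspace $\mathcal{T}\subset\mathbb{R}^D$ of dimension $d_e$ such that $f(\boldsymbol{x}_\top+\boldsymbol{x}_\perp)=f(\boldsymbol{x}_\top)$ for all $\boldsymbol{x}_\top\in\mathcal{T}$ and all $\boldsymbol{x}_\perp\in\mathcal{T}^\perp$ (the orthogonal complement of $\mathcal{T}$), and (ii) $d_e$ is the smallest integer with this property. Such a $\mathcal{T}$ (with $\dim\mathcal T=d_e$) is called the effective subspace of $f$ and $\mathcal{T}^\perp$ its constant subspace. ''$\rho$ has support the whole of $\mathbb{R}^D$'' means that the probability measure $\rho(\boldsymbol{x})\,d\boldsymbol{x}$ has support $\mathbb{R}^D$, i.e.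 gives positive mass to every nonempty open set. *)

(* Defs.v *)
From HB Require Import structures.
From mathcomp Require Import all_boot all_order all_algebra.
From mathcomp Require Import all_classical all_reals all_analysis.
Set Implicit Arguments.
Unset Strict Implicit.
Unset Printing Implicit Defensive.
Import Order.TTheory GRing.Theory Num.Theory.
Import numFieldNormedType.Exports.
Local Open Scope classical_set_scope.
Local Open Scope ring_scope.

(* Points of R^n are column vectors, and R^n carries the sigma-algebra
   generated by the coordinates (as n.-tuple R does in the library). It is the
   Borel one: see open_measurable_cV. *)
Section measurable_cV.
Context {R : realType} (n : nat).

Let coors : 'I_n -> 'cV[R]_n -> R := fun i x => x i 0.

Let cV_set0 : g_sigma_preimage coors set0.
Proof. exact: sigma_algebra0. Qed.

Let cV_setC A : g_sigma_preimage coors A -> g_sigma_preimage coors (~` A).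
Proof. exact: sigma_algebraC. Qed.

Let cV_bigcup (F : _^nat) : (forall i, g_sigma_preimage coors (F i)) ->
  g_sigma_preimage coors (\bigcup_i (F i)).
Proof. exact: sigma_algebra_bigcup. Qed.

HB.instance Definition _ := @isMeasurable.Build default_measure_display
  'cV[R]_n (g_sigma_preimage coors) cV_set0 cV_setC cV_bigcup.

Lemma measurable_cV_coord (i : 'I_n) :
  measurable_fun [set: 'cV[R]_n] (fun x : 'cV[R]_n => x i 0).
Proof.
move=> _ Y mY; rewrite setTI; apply: sub_sigma_algebra => /=.
rewrite -bigcup_seq/=; exists i => /=; first by rewrite mem_index_enum.
by exists Y => //; rewrite setTI.
Qed.

Lemma measurable_fun_cV d (T : measurableType d) (f : T -> 'cV[R]_n) :
  (forall i, measurable_fun [set: T] (fun x => f x i 0)) ->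
  measurable_fun [set: T] f.
Proof.
move=> mf.
suff fS : g_sigma_preimage (fun i => coors i \o f) `<=` measurable.
  rewrite g_sigma_preimage_comp in fS.
  by move=> _ A mA; apply: fS; exists A.
apply: smallest_sub; first exact: sigma_algebra_measurable.
rewrite -bigcup_seq; apply: bigcup_sub => i _.
by move=> A [B mB <-]; exact: mf.
Qed.

Lemma open_measurable_cV (U : set 'cV[R]_n) : open U -> measurable U.
Proof.
move=> oU.
pose c (p : 'cV[rat]_n * nat) := ball (map_mx (@ratr R) p.1) (p.2.+1%:R^-1 : R).
rewrite (_ : U = \bigcup_(p in [set p | c p `<=` U]) c p); last first.
  apply/seteqP; split => [x Ux|x [p /= pU px]]; last exact: pU.
  have /nbhs_ballP[e /= e0 eU] : nbhs x U by exact: open_nbhs_nbhs.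
  have [k _ ke] : exists2 k, true & (k.+1%:R^-1 < e / 2 :> R).
    have [N _ /(_ N (leqnn N))/=] := near_infty_natSinv_lt (PosNum (divr_gt0 e0 (@ltr0Sn R 1))).
    by move=> ?; exists N.
  have q_ (i : 'I_n) : exists q : rat, `|ratr q - x i 0| < k.+1%:R^-1.
    have /rat_in_itvoo[q] : x i 0 - k.+1%:R^-1 < x i 0 + k.+1%:R^-1 :> R.
      by rewrite ltrD2l gtrN// invr_gt0.
    by rewrite in_itv/= -ltr_distl => qx; exists q.
  pose q := \col_i sval (cid (q_ i)).
  have qP i : `|ratr (q i 0) - x i 0| < k.+1%:R^-1.
    by rewrite mxE; case: cid.
  exists (q, k) => /=.
    move=> y [_ qy]; apply: eU; split => // i j; move: (qy i j).
    rewrite mxE !ord1 /ball/= => qyi.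
    rewrite (splitr e) -(subrK (ratr (q i 0)) (x i 0)) -addrA.
    rewrite (le_lt_trans (ler_normD _ _))// ltrD// 1?distrC.
      exact: lt_trans (qP i) ke.
    by rewrite distrC; exact: lt_trans qyi ke.
  split=> [|i j]; first by rewrite invr_gt0.
  by rewrite mxE !ord1; exact: qP.
rewrite bigcup_mkcond; apply: countable_bigcupT_measurable => [|p].
  exact: countableP.
case: ifPn => // _.
rewrite (_ : c p = \bigcap_(i in [set: 'I_n])
    (fun x : 'cV[R]_n => x i 0) @^-1` ball (ratr (p.1 i 0) : R) p.2.+1%:R^-1).
  apply: fin_bigcap_measurable => // i _; rewrite -[X in measurable X]setTI.
  apply: measurable_cV_coord => //; apply: measurable_realfun.open_measurable.
  by apply: ball_open; rewrite invr_gt0.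
apply/seteqP; split => [x [_ px] i _|x px]; first by have := px i 0; rewrite mxE.
split=> [|i j]; first by rewrite invr_gt0.
by rewrite ord1 mxE; exact: px.
Qed.

End measurable_cV.

Section cons_cV.
Context {R : realType} (n : nat).

Definition cons_cV (p : R * 'cV[R]_n) : 'cV[R]_n.+1 := col_mx p.1%:M p.2.

Definition uncons_cV (x : 'cV[R]_n.+1) : R * 'cV[R]_n :=
  (x 0 0, dsubmx (x : 'cV[R]_(1 + n))).

Lemma cons_cV0 p : cons_cV p 0 0 = p.1.
Proof.
rewrite /cons_cV (_ : (0 : 'I_n.+1) = lshift n (0 : 'I_1)); last exact/val_inj.
by rewrite [LHS](@col_mxEu _ 1 n 1) mxE.
Qed.

Lemma cons_cVS p i : cons_cV p (lift ord0 i) 0 = p.2 i 0.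
Proof.
rewrite /cons_cV (_ : lift ord0 i = rshift 1 i); last exact/val_inj.
exact: (@col_mxEd _ 1 n 1).
Qed.

Lemma cons_cVK : cancel cons_cV uncons_cV.
Proof.
by move=> [a y]; rewrite /uncons_cV cons_cV0 /cons_cV col_mxKd.
Qed.

Lemma measurable_cons_cV : measurable_fun setT cons_cV.
Proof.
apply: measurable_fun_cV => i; case: (unliftP ord0 i) => [j|] ->.
  rewrite (_ : (fun _ => _) = (fun x : 'cV[R]_n => x j 0) \o snd).
    by apply: measurableT_comp => //; exact: measurable_cV_coord.
  by apply/funext => p; exact: cons_cVS.
by rewrite (_ : (fun _ => _) = fst)//; apply/funext => p; exact: cons_cV0.
Qed.

Lemma measurable_uncons_cV : measurable_fun setT uncons_cV.
Proof.
apply: measurable_fun_pair; first exact: measurable_cV_coord.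
apply: measurable_fun_cV => i.
rewrite (_ : (fun _ => _) = (fun x : 'cV[R]_n.+1 => x (rshift 1 i) 0)).
  exact: measurable_cV_coord.
by apply/funext => x; rewrite mxE.
Qed.

End cons_cV.

Section lebesgue_cVS.
Context {R : realType} (n : nat).
Variable mu : {sigma_finite_measure set 'cV[R]_n -> \bar R}.

Definition lebesgue_cVS : set 'cV[R]_n.+1 -> \bar R :=
  pushforward (@lebesgue_measure R \x mu)%E (@cons_cV R n).

Let nu : {measure set 'cV[R]_n.+1 -> \bar R} :=
  measure_function_pushforward__canonical__measure_function_Measure
    (@lebesgue_measure R \x mu)%E (@measurable_cons_cV R n).

HB.instance Definition _ := isMeasure.Build _ _ _ lebesgue_cVS
  (measure0 nu) (measure_ge0 nu) (@measure_semi_sigma_additive _ _ _ nu).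

Let sigma_finite_lebesgue_cVS : sigma_finite setT lebesgue_cVS.
Proof.
have /sigma_finiteP[F [FT ndF Foo]] := sigma_finiteT (@lebesgue_measure R).
have /sigma_finiteP[G [GT ndG Goo]] := sigma_finiteT mu.
exists (fun k => @uncons_cV R n @^-1` (F k `*` G k)).
  rewrite -preimage_bigcup -[LHS](preimage_setT (@uncons_cV R n)).
  congr (_ @^-1` _); rewrite -setXTT FT GT.
  apply/seteqP; split => [[x y] /= [[i _ Fx] [j _ Gy]]|[x y] [k _ []]].
    exists (maxn i j) => //; split => /=.
      by move: x Fx; exact/subsetPset/ndF/leq_maxl.
    by move: y Gy; exact/subsetPset/ndG/leq_maxr.
  by split; exists k.
move=> k; have [mF oF] := Foo k; have [mG oG] := Goo k; split.
  rewrite -[X in measurable X]setTI; apply: measurable_uncons_cV => //.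
  exact: measurableX.
rewrite /lebesgue_cVS /pushforward (_ : _ @^-1` _ = F k `*` G k).
  by rewrite product_measure1E// lte_mul_pinfty// ge0_fin_numE.
by rewrite -comp_preimage (_ : _ \o _ = id)//; apply/funext/cons_cVK.
Qed.

HB.instance Definition _ := Measure_isSigmaFinite.Build _ _ _ lebesgue_cVS
  sigma_finite_lebesgue_cVS.

End lebesgue_cVS.

(* Lebesgue measure on R^n: the n-fold product of Lebesgue measure on R. *)
Fixpoint lebesgue_cV {R : realType} (n : nat) :
    {sigma_finite_measure set 'cV[R]_n -> \bar R} :=
  match n with
  | 0 => \d_(0 : 'cV[R]_0)
  | n'.+1 => lebesgue_cVS (lebesgue_cV n')
  end.

Lemma lebesgue_cV_box {R : realType} n (a b : 'cV[R]_n) :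
  (forall i, a i 0 <= b i 0) ->
  lebesgue_cV n [set x : 'cV[R]_n | forall i, a i 0 <= x i 0 <= b i 0] =
  (\prod_i (b i 0 - a i 0))%:E.
Proof.
elim: n a b => [|n IHn] a b ab.
  by rewrite big_ord0 /= diracE mem_set// => -[].
rewrite /= /lebesgue_cVS /pushforward.
pose a' : 'cV[R]_n := \col_i a (lift ord0 i) 0.
pose b' : 'cV[R]_n := \col_i b (lift ord0 i) 0.
pose B := [set x : 'cV[R]_n | forall i, a' i 0 <= x i 0 <= b' i 0].
rewrite (_ : _ @^-1` _ = `[a 0 0, b 0 0] `*` B); last first.
  apply/seteqP; split => [[u x] h|[u x] /= [h0 h] i].
    split => [|i] /=; first by have := h 0; rewrite cons_cV0 in_itv.
    by have := h (lift ord0 i); rewrite cons_cVS !mxE.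
  case: (unliftP ord0 i) => [j|] ->; last by rewrite cons_cV0; move: h0; rewrite in_itv.
  by rewrite cons_cVS; have := h j; rewrite !mxE.
have mB : measurable B.
  rewrite (_ : B = \bigcap_(i in [set: 'I_n])
      (fun x : 'cV[R]_n => x i 0) @^-1` `[a' i 0, b' i 0]).
    apply: fin_bigcap_measurable => // i _; rewrite -[X in measurable X]setTI.
    exact: measurable_cV_coord.
  apply/seteqP; split => [x Bx i _|x Bx i] /=; first by rewrite in_itv/=; exact: Bx.
  by have := Bx i I; rewrite /= in_itv.
rewrite product_measure1E// IHn => [|i]; last by rewrite !mxE.
rewrite [X in (X * _)%E](@lebesgue_measure_itv R `[a 0 0, b 0 0]).
rewrite /= lte_fin big_ord_recl -EFinD.
rewrite [X in _ = (_ * X)%:E](_ : _ = \prod_i (b' i 0 - a' i 0)); last first.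
  by apply: eq_bigr => i _; rewrite !mxE.
case: ltP => [_|ba]; first by rewrite -EFinM.
by rewrite (_ : b 0 0 = a 0 0) ?subrr ?mul0r ?mul0e//; apply/le_anti/andP.
Qed.

Section C1.
Context {R : realType} (n : nat).

(* On R^n, `|_| is the sup norm in the library; differentiability and
   continuity do not depend on the choice of the norm. *)
Definition gradient (f : 'cV[R]_n -> R) (x : 'cV[R]_n) : 'cV[R]_n :=
  \col_i 'D_(delta_mx i 0) f x.

Definition continuously_differentiable (f : 'cV[R]_n -> R) :=
  (forall x, differentiable f x) /\ continuous (gradient f).

End C1.

Section densities.
Context {R : realType} (n : nat).
Implicit Type rho : 'cV[R]_n -> R.

Definition probability_density rho :=
  [/\ measurable_fun setT rho, forall x, 0 <= rho x &
      (\int[lebesgue_cV n]_x (rho x)%:E = 1)%E].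

Definition full_support rho :=
  forall U : set 'cV[R]_n, open U -> U !=set0 ->
    (0 < \int[lebesgue_cV n]_(x in U) (rho x)%:E)%E.

Definition sq_norm2 (v : 'cV[R]_n) : R := \sum_i v i 0 ^+ 2.

Definition gradient_outer_product (f rho : 'cV[R]_n -> R) : 'M[R]_n :=
  \matrix_(i, j) \int[lebesgue_cV n]_x
    ((gradient f x *m (gradient f x)^T) i j * rho x).

End densities.

Section effective_dimensionality.
Context {R : realType} (n : nat).
Implicit Types (f : 'cV[R]_n -> R) (T : {vspace 'cV[R]_n}).

Definition dotcV (x y : 'cV[R]_n) : R := \sum_i x i 0 * y i 0.

Definition orthogonal_to T (y : 'cV[R]_n) :=
  forall t : 'cV[R]_n, t \in T -> dotcV y t = 0.

Definition constant_along_complement f T :=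
  forall x y : 'cV[R]_n, x \in T -> orthogonal_to T y -> f (x + y) = f x.

Definition effective_dimensionality f (d : nat) :=
  (exists T, \dim T = d /\ constant_along_complement f T) /\
  (forall d' : nat,
    (exists T, \dim T = d' /\ constant_along_complement f T) -> (d <= d')%N).

Definition effective_subspace f T :=
  constant_along_complement f T /\ effective_dimensionality f (\dim T).

End effective_dimensionality.

Definition range_mx {R : realType} (n : nat) (C : 'M[R]_n) :
  {vspace 'cV[R]_n} := limg (linfun (mulmx C : 'cV[R]_n -> 'cV[R]_n)).

(* Main.v *)
(* For v in R^D, v^T C v is the integral of (v . grad f)^2 rho, whose integrand
   is a continuous function times rho. As rho has full support, C v = 0 iff
   v . grad f vanishes identically, i.e. iff f is invariant under translation
   along v. Hence ker C = range(C)^perp is a space of directions along which f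
   is constant, and it contains T^perp for every T such that f is constant
   along T^perp; so range(C) is the least such T. *)
Require Import Defs.
From HB Require Import structures.
From mathcomp Require Import all_boot all_order all_algebra.
From mathcomp Require Import all_classical all_reals all_analysis.
From mathcomp Require Import measurable_realfun ring lra.
Set Implicit Arguments.
Unset Strict Implicit.
Unset Printing Implicit Defensive.
Import Order.TTheory GRing.Theory Num.Theory.
Import numFieldNormedType.Exports.
Local Open Scope classical_set_scope.
Local Open Scope ring_scope.

(** * Orthogonal complements, and the range of a symmetric matrix *)

Section dot_product.
Context {R : realType} (n : nat).
Implicit Types (u v x y : 'cV[R]_n) (T : {vspace 'cV[R]_n}).

Lemma dotcVE x y : dotcV x y = (x^T *m y) 0 0.
Proof. by rewrite mxE; apply: eq_bigr => i _; rewrite mxE. Qed.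

Lemma dotcVC x y : dotcV x y = dotcV y x.
Proof. by apply: eq_bigr => i _; rewrite mulrC. Qed.

Lemma dotcVDr x y z : dotcV x (y + z) = dotcV x y + dotcV x z.
Proof. by rewrite !dotcVE mulmxDr mxE. Qed.

Lemma dotcVZr a x y : dotcV x (a *: y) = a * dotcV x y.
Proof. by rewrite !dotcVE -scalemxAr mxE. Qed.

Lemma dotcV0r x : dotcV x 0 = 0.
Proof. by rewrite dotcVE mulmx0 mxE. Qed.

Lemma dotcV_sumr (I : Type) (r : seq I) (F : I -> 'cV[R]_n) x :
  dotcV x (\sum_(i <- r) F i) = \sum_(i <- r) dotcV x (F i).
Proof.
elim/big_rec2: _ => [|i a b _ <-]; first exact: dotcV0r.
exact: dotcVDr.
Qed.

Lemma dotcV_eq0 x : dotcV x x = 0 -> x = 0.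
Proof.
move=> /eqP; rewrite psumr_eq0; last by move=> i _; rewrite -expr2 sqr_ge0.
move=> /allP x0; apply/colP => i; rewrite mxE; apply/eqP.
by have := x0 i (mem_index_enum i); rewrite -expr2 sqrf_eq0.
Qed.

Lemma dotcV_symmx (A : 'M[R]_n) x y :
  A^T = A -> dotcV x (A *m y) = dotcV (A *m x) y.
Proof. by move=> symA; rewrite !dotcVE trmx_mul symA mulmxA. Qed.

(** Reduces orthogonality to [\dim T] linear equations, so that the complement becomes the kernel of
    a matrix. *)
Lemma orthogonal_to_basisP T y :
  orthogonal_to T y <-> forall i : 'I_(\dim T), dotcV (vbasis T)`_i y = 0.
Proof.
split=> [yT i|yT t tT].
  rewrite dotcVC; apply: yT; apply: vbasis_mem; apply: mem_nth.
  by rewrite size_tuple.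
rewrite (coord_vbasis tT) dotcV_sumr big1// => i _.
by rewrite dotcVZr dotcVC yT mulr0.
Qed.

(* The complement of T is the kernel of a linear map into R^(dim T), so it has
   dimension at least n - dim T; it meets T trivially. *)
Lemma orthogonal_decomposition T x :
  exists t y, [/\ t \in T, orthogonal_to T y & x = t + y].
Proof.
pose B : 'M[R]_(\dim T, n) := \matrix_(i, j) (vbasis T)`_i j 0.
have BE y i : (B *m y) i 0 = dotcV (vbasis T)`_i y.
  by rewrite mxE; apply: eq_bigr => j _; rewrite mxE.
pose L := linfun (mulmx B : 'cV[R]_n -> 'cV[R]_(\dim T)).
have kerP y : y \in lker L -> orthogonal_to T y.
  rewrite memv_ker lfunE/= => /eqP By0; apply/orthogonal_to_basisP => i.
  by rewrite -BE By0 mxE.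
have TL0 : (T :&: lker L = 0)%VS.
  apply/eqP; rewrite -subv0; apply/subvP => y; rewrite memv_cap => /andP[yT yL].
  by rewrite memv0; apply/eqP/dotcV_eq0/(kerP _ yL).
have TLf : (T + lker L = fullv)%VS.
  apply/eqP; rewrite eqEdim subvf dimv_disjoint_sum//=.
  rewrite -(limg_ker_dim L fullv) capfv addnC leq_add2r.
  by rewrite (leq_trans (dimvS (subvf _)))// dimvf dim_matrix mulr1.
have : x \in (T + lker L)%VS by rewrite TLf memvf.
by move=> /memv_addP[t tT [y yL xE]]; exists t, y; split=> //; exact: kerP.
Qed.

Lemma range_mxP (A : 'M[R]_n) x :
  reflect (exists y, x = A *m y) (x \in range_mx A).
Proof.
apply: (iffP memv_imgP) => [[y _ ->]|[y ->]]; exists y => //.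
- by rewrite lfunE.
- exact: memvf.
- by rewrite lfunE.
Qed.

(** In the full-rank factorization of [A] as [col_base A *m row_base A], the right factor is onto
    and the left one injective on columns, so the range is an isomorphic image of a space of
    dimension [\rank A]. *)
Lemma dim_range_mx (A : 'M[R]_n) : \dim (range_mx A) = \rank A.
Proof.
pose L := linfun (mulmx (col_base A) : 'cV[R]_(\rank A) -> 'cV[R]_n).
have -> : range_mx A = limg L.
  apply/vspaceP => x; apply/range_mxP/memv_imgP => [[y ->]|[y _ ->]].
    exists (row_base A *m y); first exact: memvf.
    by rewrite lfunE/= mulmxA mulmx_base.
  (* [pinvmx (row_base A)] is a right inverse, because [row_base A] has independent rows. *)
  exists (pinvmx (row_base A) *m y); rewrite lfunE/=.
  transitivity (col_base A *m row_base A *m (pinvmx (row_base A) *m y)).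
    by rewrite mulmxA -(mulmxA (col_base A)) mulmxVp ?row_base_free// mulmx1.
  by rewrite mulmx_base.
rewrite limg_dim_eq ?dimvf ?dim_matrix ?mulr1//.
rewrite capfv; apply/eqP; rewrite -subv0; apply/subvP => y.
rewrite memv_ker lfunE/= memv0 => /eqP Ay0.
by rewrite -[y]mul1mx -(mulVpmx (col_base_full A)) -mulmxA Ay0 mulmx0.
Qed.

(** If y is orthogonal to the range, testing it against A (A y) gives |A y|^2 = 0 by symmetry. *)
Lemma orthogonal_to_range_mx (A : 'M[R]_n) y :
  A^T = A -> orthogonal_to (range_mx A) y <-> A *m y = 0.
Proof.
move=> symA; split=> [yA|Ay0 _ /range_mxP[x ->]].
  apply: dotcV_eq0; rewrite -dotcV_symmx//.
  by apply: yA; apply/range_mxP; exists (A *m y).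
by rewrite dotcV_symmx// Ay0 dotcVC dotcV0r.
Qed.

End dot_product.

(** * Directional derivatives and invariance under translation *)

Section directional_derivative.
Context {R : realType} (n : nat).
Implicit Types (f : 'cV[R]_n -> R) (v x : 'cV[R]_n).

Lemma derive_dotcV_gradient f v x :
  differentiable f x -> 'D_v f x = dotcV v (gradient f x).
Proof.
move=> df; rewrite deriveE// {1}(matrix_sum_delta v) linear_sum.
apply: eq_bigr => i _; rewrite big_ord1 linearZ/= mxE.
by rewrite -deriveE.
Qed.

(** The difference quotient of the restriction to the line, at t, is the same function of h as that
    of f at x + t v along v. *)
Lemma is_derive_line f v x (t : R) : differentiable f (x + t *: v) ->
  is_derive t 1 (fun s : R => f (x + s *: v)) ('D_v f (x + t *: v)).
Proof.
have lineE :
  (fun h : R =>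
    h^-1 *: (((fun s : R => f (x + s *: v)) \o shift t) (h *: 1)
             - f (x + t *: v))) =
  (fun h : R =>
    h^-1 *: ((f \o shift (x + t *: v)) (h *: v) - f (x + t *: v))).
  apply/funext => h /=; congr (_ *: (f _ - _)).
  by rewrite -[h *: 1]/(h * 1) mulr1 scalerDl addrCA.
move=> df; split; last by rewrite /derive lineE.
by rewrite /derivable lineE; exact: diff_derivable.
Qed.

(** The restriction of f to the line through x along v has zero derivative, hence takes the same
    value at parameters 0 and 1. *)
Lemma derive_eq0_invariant f v : (forall x, differentiable f x) ->
  (forall x, 'D_v f x = 0) -> forall x, f (x + v) = f x.
Proof.
move=> df Df0 x.
have lineD (t : R) : is_derive t 1 (fun s : R => f (x + s *: v)) 0.
  by have := is_derive_line (df (x + t *: v)); rewrite Df0.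
by have := is_derive_0_is_cst 1 0 lineD; rewrite scale1r scale0r addr0.
Qed.

(** Write x = t + y with t in T and y orthogonal to T. Then x and x + h v both differ from t by a
    vector orthogonal to T, so f equals f t at both and every difference quotient is 0. *)
Lemma constant_along_complement_derive f (T : {vspace 'cV[R]_n}) v x :
  constant_along_complement f T -> orthogonal_to T v -> 'D_v f x = 0.
Proof.
move=> fT vT; have [t [y [tT yT ->]]] := orthogonal_decomposition T x.
rewrite /derive (_ : (fun _ => _) = cst 0); first by rewrite lim_cst.
apply/funext => h /=; rewrite addrCA !fT ?subrr ?scaler0// => s sT.
by rewrite dotcVC dotcVDr dotcVZr dotcVC vT// dotcVC yT// mulr0 addr0.
Qed.

End directional_derivative.

(** * Continuous functions integrated against a density of full support *)

Section continuous_functions.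
Context {R : realType} (n : nat).

Lemma continuous_measurable_cV (h : 'cV[R]_n -> R) :
  continuous h -> measurable_fun setT h.
Proof.
move=> /continuousP ch.
apply: (measurability _ (RGenOpens.measurableE R)).
move=> _ [_ [a [b ->] <-]]; rewrite setTI; apply: open_measurable_cV.
exact/ch/interval_open.
Qed.

Lemma continuous_cV_coord (g : 'cV[R]_n -> 'cV[R]_n) i :
  continuous g -> continuous (fun x => g x i 0).
Proof.
move=> cg x; apply: (@continuous_comp _ _ _ g (fun y : 'cV[R]_n => y i 0)).
  exact: cg.
exact: coord_continuous.
Qed.

Lemma continuous_dotcV (g : 'cV[R]_n -> 'cV[R]_n) v :
  continuous g -> continuous (fun x => dotcV v (g x)).
Proof.
move=> cg; rewrite /dotcV; elim: (index_enum _) => [|i r IHr] x.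
  rewrite (_ : (fun _ => _) = cst 0); first exact: cst_continuous.
  by apply/funext => y; rewrite big_nil.
rewrite (_ : (fun _ => _) =
  (fun y => v i 0 * g y i 0 + \sum_(j <- r) v j 0 * g y j 0)); last first.
  by apply/funext => y; rewrite big_cons.
have cgi : {for x, continuous (fun y => g y i 0)} by exact: continuous_cV_coord.
have cvgi := continuousM (@cst_continuous _ _ (v i 0) x) cgi.
exact: (continuousD cvgi (IHr x)).
Qed.

(** If h x > 0, then h exceeds h x / 2 on an open neighbourhood U of x, and U has positive mass; the
    integral is then at least h x / 2 times that mass. *)
Lemma full_support_eq0 (rho h : 'cV[R]_n -> R) :
  measurable_fun setT rho -> (forall x, 0 <= rho x) -> full_support rho ->
  continuous h -> (forall x, 0 <= h x) ->
  (\int[lebesgue_cV n]_x (h x * rho x)%:E = 0)%E -> forall x, h x = 0.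
Proof.
move=> mrho rho0 srho ch h0 int0 x; apply/eqP; rewrite eq_le h0 andbT leNgt.
apply/negP => hx.
pose U := h @^-1` [set y | h x / 2 < y].
have oU : open U by move/continuousP : ch; apply; exact: open_gt.
have mU : measurable U by exact: open_measurable_cV.
have Ux : U x by rewrite /U/= ltr_pdivrMr// ltr_pMr// ltr1n.
have mhrho : measurable_fun setT (EFin \o (fun x => h x * rho x)).
  apply/measurable_EFinP; apply: measurable_funM => //.
  exact: continuous_measurable_cV.
have mErho A : measurable_fun A (EFin \o rho).
  by apply/measurable_EFinP; apply: measurable_funTS.
have : (0 < (h x / 2)%:E * \int[lebesgue_cV n]_(y in U) (rho y)%:E)%E.
  by rewrite mule_gt0 ?lte_fin ?divr_gt0//; apply: srho => //; exists x.
rewrite ltNge => /negP; apply.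
rewrite -int0 -ge0_integralZl_EFin//; last 2 first.
- by move=> y _; rewrite lee_fin.
- by rewrite divr_ge0// ltW.
(* On U, h dominates the constant h x / 2; enlarging U to the whole space can only increase the
   integral of a nonnegative function. *)
apply: (@le_trans _ _ (\int[lebesgue_cV n]_(y in U) (h y * rho y)%:E)%E).
  apply: ge0_le_integral => //.
  - by move=> y _; rewrite -EFinM lee_fin mulr_ge0// divr_ge0// ltW.
  - by apply: measurable_funeM.
  - exact: measurable_funTS.
  - by move=> y Uy; rewrite -EFinM lee_fin ler_wpM2r// ltW.
apply: ge0_subset_integral => //.
by move=> y _; rewrite lee_fin mulr_ge0.
Qed.

End continuous_functions.

Lemma Rintegral_sum d (T : measurableType d) (R : realType)
    (mu : {measure set T -> \bar R}) (D : set T) (I : Type) (F : I -> T -> R)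
    (s : seq I) :
  measurable D -> (forall i, mu.-integrable D (EFin \o F i)) ->
  \int[mu]_(x in D) (\sum_(i <- s) F i x) =
  \sum_(i <- s) \int[mu]_(x in D) F i x.
Proof.
move=> mD intF; elim: s => [|i s IHs].
  rewrite big_nil; under eq_Rintegral do rewrite big_nil.
  (* The integral of the constant 0 is 0 times [fine (mu D)], hence 0 even if D has infinite
     measure. *)
  by rewrite Rintegral_cst// mul0r.
under eq_Rintegral do rewrite big_cons.
rewrite RintegralD//; first by rewrite big_cons IHs.
rewrite (_ : _ \o _ = fun x => (\sum_(j <- s) (F j x)%:E)%E).
  by apply: integrable_sum => // j _; exact: intF.
by apply/funext => x; rewrite /= -sumEFin.
Qed.

(** * The quadratic form of C, its kernel and its range *)

Section gradient_outer_product.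
Context {R : realType} (n : nat) (f rho : 'cV[R]_n -> R).
Hypothesis C1f : continuously_differentiable f.
Hypothesis rho_density : probability_density rho.
Hypothesis rho_support : full_support rho.
Hypothesis grad_L2 :
  (\int[lebesgue_cV n]_x (sq_norm2 (gradient f x) * rho x)%:E < +oo)%E.

Let g := gradient f.
Let C := gradient_outer_product f rho.
Let mrho : measurable_fun setT rho. Proof. by case: rho_density. Qed.
Let rho0 x : 0 <= rho x. Proof. by case: rho_density. Qed.

Let outer i j x : R := (g x *m (g x)^T) i j * rho x.

Let outerE i j x : outer i j x = g x i 0 * g x j 0 * rho x.
Proof. by rewrite /outer mxE big_ord1 !mxE. Qed.

Let measurable_gradient i : measurable_fun setT (fun x => g x i 0).
Proof.
by apply: continuous_measurable_cV; apply: continuous_cV_coord; case: C1f.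
Qed.

Let ler_sq_norm2 i x : g x i 0 ^+ 2 <= sq_norm2 (g x).
Proof.
by rewrite /sq_norm2 (bigD1 i)//= lerDl sumr_ge0// => j _; rewrite sqr_ge0.
Qed.

(** The entry is dominated by |grad f|^2 rho. This makes the entries of C genuine integrals rather
    than values of [fine] at an infinite or ill-defined one. *)
Lemma integrable_gradient_outer i j :
  (lebesgue_cV n).-integrable setT
    (EFin \o (fun x => (gradient f x *m (gradient f x)^T) i j * rho x)).
Proof.
have mN : measurable_fun setT (EFin \o (fun x => sq_norm2 (g x) * rho x)).
  apply/measurable_EFinP; apply: measurable_funM => //.
  by apply: measurable_sum => k; apply: measurable_funX.
have N0 x : 0 <= sq_norm2 (g x) by apply: sumr_ge0 => k _; exact: sqr_ge0.
have intN : (lebesgue_cV n).-integrable setT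
    (EFin \o (fun x => sq_norm2 (g x) * rho x)).
  apply/integrableP; split => //; rewrite (le_lt_trans _ grad_L2)//.
  apply: ge0_le_integral => //; first exact: measurableT_comp.
  by move=> x _; rewrite /= ger0_norm// mulr_ge0.
apply: le_integrable intN => //.
  apply/measurable_EFinP; rewrite (_ : (fun _ => _) = outer i j)//.
  rewrite (funext (outerE i j)); apply: measurable_funM => //.
  exact: measurable_funM.
move=> x _; rewrite /= lee_fin -/(outer i j x) outerE !normrM.
rewrite (ger0_norm (rho0 x)) ler_wpM2r//.
rewrite [leRHS]ger0_norm//.
(* With a^2 and b^2 both at most N = |grad f|^2, a b <= (a^2 + b^2) / 2 <= N. *)
have := ler_sq_norm2 i x; have := ler_sq_norm2 j x.
rewrite -(real_normK (num_real (g x i 0))) -(real_normK (num_real (g x j 0))).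
have := normr_ge0 (g x i 0); have := normr_ge0 (g x j 0).
set a := `|g x i 0|; set b := `|g x j 0| => *; nra.
Qed.

Lemma tr_gradient_outer_product : C^T = C.
Proof.
apply/matrixP => i j; rewrite !mxE; apply: eq_Rintegral => x _.
by rewrite -!/(outer _ _ _) !outerE (mulrC (g x j 0)).
Qed.

(** Expanding (u . grad f)(v . grad f) rho into these terms reduces its integrability and its
    integral to those of the entries of C. *)
Let F (u v : 'cV[R]_n) i j x : R := u i 0 * v j 0 * outer i j x.

Let integrable_F u v i j : (lebesgue_cV n).-integrable setT (EFin \o F u v i j).
Proof.
have := integrableZl measurableT (u i 0 * v j 0)
  (integrable_gradient_outer i j).
by apply: eq_integrable.
Qed.

Let integrable_sumF u v i : (lebesgue_cV n).-integrable setT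
  (EFin \o (fun x => \sum_j F u v i j x)).
Proof.
rewrite (_ : _ \o _ = fun x => (\sum_j (F u v i j x)%:E)%E).
  by apply: integrable_sum => // j _; exact: integrable_F.
by apply/funext => x; rewrite /= -sumEFin.
Qed.

Let sumFE u v x :
  dotcV u (g x) * dotcV v (g x) * rho x = \sum_i \sum_j F u v i j x.
Proof.
rewrite /dotcV big_distrlr big_distrl /=.
apply: eq_bigr => i _; rewrite big_distrl; apply: eq_bigr => j _ /=.
by rewrite /F outerE; ring.
Qed.

Lemma integrable_dotcV_gradient u v : (lebesgue_cV n).-integrable setT
  (EFin \o (fun x => dotcV u (gradient f x) * dotcV v (gradient f x) * rho x)).
Proof.
rewrite (_ : _ \o _ = fun x => (\sum_i (\sum_j F u v i j x)%:E)%E).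
  by apply: integrable_sum => // i _; exact: integrable_sumF.
by apply/funext => x; rewrite /= sumFE -sumEFin.
Qed.

Lemma dotcV_gradient_outer_product u v :
  dotcV u (C *m v) =
  \int[lebesgue_cV n]_x
    (dotcV u (gradient f x) * dotcV v (gradient f x) * rho x).
Proof.
under eq_Rintegral do rewrite sumFE.
rewrite Rintegral_sum//; apply: eq_bigr => i _.
rewrite Rintegral_sum// mxE big_distrr; apply: eq_bigr => j _ /=.
rewrite RintegralZl//; last exact: integrable_gradient_outer.
by rewrite mxE; ring.
Qed.

(* v^T C v is the rho-average of the square of the continuous function
   v . grad f, so it vanishes only if that function does. *)
Lemma gradient_outer_product_kernel v :
  C *m v = 0 <-> forall x, dotcV v (g x) = 0.
Proof.
split=> [Cv0 x|vg0]; last first.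
  apply: dotcV_eq0; rewrite dotcV_gradient_outer_product.
  under eq_Rintegral do rewrite vg0 mulr0 mul0r.
  by rewrite Rintegral_cst// mul0r.
have [_ cg] := C1f.
pose h x := dotcV v (g x) * dotcV v (g x).
suff : h x = 0 by move/eqP; rewrite mulf_eq0 orbb => /eqP.
have cvg : continuous (fun x => dotcV v (g x)) by exact: continuous_dotcV.
apply: (full_support_eq0 mrho rho0 rho_support) => [y|y|].
- exact: (continuousM (cvg y) (cvg y)).
- by rewrite /h -expr2 sqr_ge0.
(* [full_support_eq0] needs the extended integral to vanish, while C only records its image under
   [fine], which also sends infinities to 0; integrability excludes them. *)
have h_fin : (\int[lebesgue_cV n]_y (h y * rho y)%:E)%E \is a fin_num.
  by apply: integrable_fin_num => //; exact: integrable_dotcV_gradient.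
rewrite -(fineK h_fin); congr _%:E.
by rewrite -[LHS]dotcV_gradient_outer_product Cv0 dotcV0r.
Qed.

Lemma constant_along_range_complement :
  constant_along_complement f (range_mx C).
Proof.
move=> x y _ /(orthogonal_to_range_mx _ tr_gradient_outer_product).
move=> /gradient_outer_product_kernel yg0; have [df _] := C1f.
by apply: derive_eq0_invariant => // z; rewrite derive_dotcV_gradient.
Qed.

(** Split x in range(C) as t + y along T and its complement. f is constant in the direction y, so y
    lies in ker C and is orthogonal to x; thus 0 = y . x = |y|^2 and x = t. *)
Lemma range_sub_constant_along (T : {vspace 'cV[R]_n}) :
  constant_along_complement f T -> (range_mx C <= T)%VS.
Proof.
move=> fT; apply/subvP => x xC; have [df _] := C1f.
have [t [y [tT yT xE]]] := orthogonal_decomposition T x.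
have yC : orthogonal_to (range_mx C) y.
  apply/(orthogonal_to_range_mx _ tr_gradient_outer_product).
  apply/gradient_outer_product_kernel => z.
  by rewrite -derive_dotcV_gradient// (constant_along_complement_derive z fT).
have y0 : y = 0.
  by apply: dotcV_eq0; have := yC _ xC; rewrite xE dotcVDr (yT _ tT) add0r.
by rewrite xE y0 addr0.
Qed.

(** range(C) attains the dimension [\rank C], and its inclusion in every admissible T makes this the
    minimum; a minimum is unique. *)
Lemma effective_dimensionality_rank d :
  effective_dimensionality f d <-> \rank C = d.
Proof.
have rankC : effective_dimensionality f (\rank C).
  split=> [|d' [T [<- /range_sub_constant_along CT]]].
    exists (range_mx C); split; first exact: dim_range_mx.
    exact: constant_along_range_complement.
  by rewrite -dim_range_mx dimvS.
split=> [[exd mind]|<-]//; have [exC minC] := rankC.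
by apply/eqP; rewrite eqn_leq minC// mind.
Qed.

(** An effective subspace contains range(C) and has the same dimension, so the two coincide. *)
Lemma effective_subspace_range (T : {vspace 'cV[R]_n}) :
  effective_subspace f T <-> T = range_mx C.
Proof.
split=> [[/range_sub_constant_along CT /effective_dimensionality_rank rT]|->].
  by apply/esym/eqP; rewrite eqEdim CT dim_range_mx rT leqnn.
split; first exact: constant_along_range_complement.
by apply/effective_dimensionality_rank; rewrite dim_range_mx.
Qed.

End gradient_outer_product.

Theorem theorem2p9 (R : realType) (D : nat) (f rho : 'cV[R]_D -> R) :
  (1 <= D)%N ->
  continuously_differentiable f ->
  probability_density rho ->
  full_support rho ->
  (\int[lebesgue_cV D]_x (sq_norm2 (gradient f x) * rho x)%:E < +oo)%E ->
  let C := gradient_outer_product f rho in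
  forall d : nat, (d <= D)%N ->
    (\rank C = d <-> effective_dimensionality f d) /\
    (\rank C = d ->
      forall T : {vspace 'cV[R]_D}, effective_subspace f T <-> T = range_mx C).
Proof.
move=> _ C1f rho_density rho_support grad_L2 C d _; split.
  by apply: iff_sym; exact: effective_dimensionality_rank.
by move=> _ T; exact: effective_subspace_range.
Qed.
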